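(* Let $N>1$ be an integer, let $\Omega\subset\mathbb{R}^N$ be either a bounded open set or the whole space $\mathbb{R}^N$, and let $p>1$, $\gamma>p-1$, $\lambda\ge0$, $\nu>0$, $c_H>0$, $q\ge1$ and $f\in\mathcal{L}^{1,\frac{N}{q}}(\Omega)$. Let $\mathcal{A}:\Omega\times\mathbb{R}\times\mathbb{R}^N\to\mathbb{R}^N$ be a Carathéodory function with $|\mathcal{A}(x,s,\xi)|\le\nu|\xi|^{p-1}$ for every $(s,\xi)\in\mathbb{R}\times\mathbb{R}^N$ and a.e. $x\in\Omega$, and let $\mathcal{B}_1:\Omega\times\mathbb{R}\times\mathbb{R}^N\to\mathbb{R}$ satisfy $\mathcal{B}_1(x,s,\xi)\ge c_H|\xi|^\gamma-\lambda s-f(x)$. Let $u$ be a distributional supersolution of $$-\mathrm{div}(\mathcal{A}(x,u,\nabla u))\ge\mathcal{B}_1(x,u,\nabla u)\quad\text{in }\Omega$$ such that $\lambda u^+\in\mathcal{L}^{1,\frac{N}{q}}(\Omega)$. Then, for every pair of concentric balls $B_t\subset B_R\subset\Omega$ (of radii $t<R$), we have $$\int_{B_t}|\nabla u|^\gamma\,dx+\lambda\int_{B_t}u^-\,dx\le K\frac{R^N}{(R-t)^s},$$ where $s=\max\left\{\frac{N}{q},\frac{\gamma}{\gamma-(p-1)}\right\}$ and $K$ is a constant depending on $\nu,p,\gamma,q,N,c_H$ and on $\|f+\lambda u^+\|_{\mathcal{L}^{1,\frac{N}{q}}(B_R)}$.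
   Context: Notation: $u^+=\max\{u,0\}$, $u^-=\max\{-u,0\}$. $B_r(z)$ is the Euclidean ball of center $z$ and radius $r$. A Carathéodory function is measurable in $x$ and continuous in $(s,\xi)$. Morrey space: for an open set $E$ (here $\Omega$ or $B_R$), $\mathcal{L}^{1,\frac{N}{q}}(E)$ is the space of $h\in L^1(E)$ for which there is $C$ with $\int_{B_r(z)\cap E}|h|\,dx\le Cr^{N-\frac{N}{q}}$ for all $z\in E$ and $r\in(0,\mathrm{diam}(E)]$ (all $r>0$ if $E=\mathbb{R}^N$), with norm $\|h\|_{\mathcal{L}^{1,\frac{N}{q}}(E)}=\sup_{z\in E,\,0<r\le\mathrm{diam}(E)}r^{\frac{N}{q}-N}\|h\|_{L^1(B_r(z)\cap E)}$. Distributional supersolution: $u\in W^{1,p}_{\mathrm{loc}}(\Omega)$, $\mathcal{A}(\cdot,u,\nabla u)\in L^{p'}_{\mathrm{loc}}(\Omega)$ with $p'=\frac{p}{p-1}$, $\mathcal{B}_1(\cdot,u,\nabla u)\in L^1_{\mathrm{loc}}(\Omega)$ and $$\int_\Omega\mathcal{A}(x,u,\nabla u)\cdot\nabla\varphi\,dx\ge\int_\Omega\mathcal{B}_1(x,u,\nabla u)\varphi\,dx\qquad\text{for all }\varphi\in C^1_0(\Omega),\ \varphi\ge0.$$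
   Formalization: The constant K may also depend on an arbitrary upper bound for R−t; with K depending only on the listed quantities and R−t unbounded, the claim fails, e.g. for A=0, λ=0, f=R^{-N/q}, u linear when N/q<γ/(γ-(p-1)). *)

(* Defs.v *)
From HB Require Import structures.
From mathcomp Require Import all_boot all_order all_algebra.
From mathcomp Require Import all_classical all_reals all_analysis.

Set Implicit Arguments.
Unset Strict Implicit.
Unset Printing Implicit Defensive.

Import Order.TTheory GRing.Theory Num.Theory.
Import numFieldNormedType.Exports.

Local Open Scope classical_set_scope.
Local Open Scope ring_scope.

Section euclidean.
Context {R : realType} {N : nat}.
Implicit Types x y z : 'rV[R]_N.

Definition dotv x y : R := \sum_i x 0 i * y 0 i.

(* The norm `|x| of the library on 'rV[R]_N is the sup norm. *)
Definition enorm x : R := Num.sqrt (dotv x x).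

Definition eball z (r : R) : set 'rV[R]_N := [set x | enorm (x - z) < r].

(* Valued in \bar R: diam [set: 'rV[R]_N] = +oo as soon as 0 < N. *)
Definition diam (E : set 'rV[R]_N) : \bar R :=
  ereal_sup [set (enorm (xy.1 - xy.2))%:E | xy in E `*` E].

End euclidean.

(* Lebesgue measure on R^N: the outer measure A |-> inf sum_k vol (Q k), the
   infimum being over the sequences Q of open boxes that cover A, restricted to
   its Caratheodory-measurable sets. A sequence may skip indices (None), so that
   set0 has measure 0 also when N = 0, where every box has volume 1. *)
Section lebesgue_outer.
Context (R : realType) (N : nat).
Local Notation vec := 'rV[R]_N.

Definition obox (c : option (vec * vec)) : set vec :=
  if c is Some (a, b) then [set x | forall i, a 0 i < x 0 i < b 0 i] else set0.

Definition vol (c : option (vec * vec)) : \bar R :=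
  if c is Some (a, b) then (\prod_i Num.max 0 (b 0 i - a 0 i))%:E else 0%E.

Definition lebesgue_outer (A : set vec) : \bar R :=
  ereal_inf [set (\sum_(k <oo) vol (Q k))%E
            | Q in [set Q : nat -> option (vec * vec) |
                    A `<=` \bigcup_k obox (Q k)]].

Local Open Scope ereal_scope.

Lemma vol_ge0 c : 0 <= vol c.
Proof.
case: c => [[a b]|]//=; rewrite lee_fin; apply: prodr_ge0 => i _.
by rewrite le_max lexx.
Qed.

Lemma lebesgue_outer_ge0 A : 0 <= lebesgue_outer A.
Proof.
apply: le_ereal_inf_tmp => _ [Q _ <-].
by apply: nneseries_ge0 => k _ _; exact: vol_ge0.
Qed.

Lemma lebesgue_outer0 : lebesgue_outer set0 = 0.
Proof.
apply/eqP; rewrite eq_le lebesgue_outer_ge0 andbT.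
apply: ereal_inf_lbound; exists (fun=> None) => //=.
by rewrite eseries0.
Qed.

Lemma le_lebesgue_outer : {homo lebesgue_outer : A B / A `<=` B >-> A <= B}.
Proof.
move=> A B AB; apply: ereal_inf_le_tmp => _ [Q BQ <-].
by exists Q => //; exact: subset_trans AB BQ.
Qed.

Lemma lebesgue_outer_sigma_subadditive : sigma_subadditive lebesgue_outer.
Proof.
move=> A; have [[i ioo]|] := pselect (exists i, lebesgue_outer (A i) = +oo).
  rewrite (eseries_pinfty _ _ ioo) ?leey// => n _.
  by rewrite -ltNye (lt_le_trans _ (lebesgue_outer_ge0 _)).
rewrite -forallNE => Aoo.
apply/lee_addgt0Pr => _/posnumP[e].
rewrite (le_trans _ (epsilon_trick _ _ _))//; last first.
  by move=> n; exact: lebesgue_outer_ge0.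
pose P n (B : nat -> option (vec * vec)) := A n `<=` \bigcup_k obox (B k) /\
  \sum_(k <oo) vol (B k) <=
    lebesgue_outer (A n) + (e%:num / (2 ^ n.+1)%:R)%:E.
have [G PG] : {G : nat -> nat -> option (vec * vec) & forall n, P n (G n)}.
  apply: (@choice _ _ P) => n; rewrite /P.
  have fn : lebesgue_outer (A n) \is a fin_num.
    by rewrite ge0_fin_numE ?lebesgue_outer_ge0// ltey; apply/eqP; exact: Aoo.
  have en1 : (0 < e%:num / (2 ^ n.+1)%:R)%R by [].
  have [x [B AB <-]] := lb_ereal_inf_adherent en1 fn.
  by exists B; split => //; exact/ltW.
have vG_ge0 x : 0 <= (vol \o uncurry G) x by exact: vol_ge0.
apply: (@le_trans _ _ (\esum_(i in setT) (vol \o uncurry G) i)).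
  apply: ereal_inf_lbound => /=.
  have /card_esym/ppcard_eqP[f] := card_nat2.
  exists (uncurry G \o f).
    move=> t [i _] /(PG i).1 [j _ Bijt]; exists (f^-1%FUN (i, j)) => //=.
    by rewrite invK ?inE.
  rewrite -(esum_pred_image (vol \o uncurry G) _ xpredT) ?[fun=> _]set_true//.
  by rewrite image_eq.
rewrite (_ : esum _ _ = \sum_(i <oo) \sum_(j <oo ) vol (G i j)); last first.
  pose J : nat -> set (nat * nat) := fun i => [set (i, j) | j in setT].
  rewrite (_ : setT = \bigcup_k J k); last first.
    by rewrite predeqE => -[a b]; split => // _; exists a => //; exists b.
  rewrite esum_bigcupT /=; last 2 first.
    - apply/trivIsetP => i j _ _ ij.
      rewrite predeqE => -[n m] /=; split => //= -[] [_] _ [<-{n} _].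
      by move=> [m' _] [] /esym/eqP; rewrite (negbTE ij).
    - by move=> /= [n m]; exact: vol_ge0.
  rewrite -(image_id [set: nat]) -fun_true esum_pred_image//; last first.
    by move=> n _; apply: esum_ge0 => x _; exact: vG_ge0.
  apply: eq_eseriesr => /= j _.
  rewrite -(esum_pred_image (vol \o uncurry G) (pair j) predT)//=; last 2 first.
    - by move=> n _; exact: vol_ge0.
    - by move=> ? ? _ _; exact: (@can_inj _ _ _ snd).
  by congr esum; rewrite predeqE => -[a b]; split; move=> [i _ <-]; exists i.
apply: lee_lim.
- apply: is_cvg_nneseries => n *.
  by apply: nneseries_ge0 => m *; exact: (vG_ge0 (n, m)).
- apply: is_cvg_nneseries => n *.
  by apply: adde_ge0 => //; exact: lebesgue_outer_ge0.
- by near=> n; apply: lee_sum => i _; exact: (PG i).2.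
Unshelve. all: by end_near. Qed.

HB.instance Definition _ := isOuterMeasure.Build R vec lebesgue_outer
  lebesgue_outer0 lebesgue_outer_ge0 le_lebesgue_outer
  lebesgue_outer_sigma_subadditive.

HB.instance Definition _ :=
  @isMeasurable.Build (caratheodory_display lebesgue_outer) vec
    (caratheodory_measurable lebesgue_outer)
    (caratheodory_measurable_set0 lebesgue_outer)
    (@caratheodory_measurable_setC _ _ lebesgue_outer)
    (@caratheodory_measurable_bigcup _ _ lebesgue_outer).

Definition leb : set vec -> \bar R := lebesgue_outer.

HB.instance Definition _ := isMeasure.Build _ vec R leb
  (@caratheodory_measure0 R vec lebesgue_outer)
  (@caratheodory_measure_ge0 R vec lebesgue_outer)
  (@caratheodory_measure_sigma_additive R vec lebesgue_outer).

End lebesgue_outer.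
Arguments leb {R N}.

Section function_spaces.
Context {R : realType} {N : nat}.
Local Notation vec := 'rV[R]_N.
Implicit Types (Om E : set vec) (u h phi : vec -> R) (F : vec -> vec).

Definition locally_Lp (Om : set vec) (p : R) (h : vec -> R) : Prop :=
  measurable_fun Om h /\
  forall C : set vec, compact C -> C `<=` Om ->
    (\int[leb]_(x in C) (`|h x| `^ p)%:E < +oo)%E.

(* Measurability is required of each component: measurable_fun Om F would refer
   to the Lebesgue, rather than the Borel, sigma-algebra on the codomain. *)
Definition vmeasurable Om F : Prop :=
  forall i, measurable_fun Om (fun x => F x 0 i).

Definition locally_Lp_vec Om (p : R) F : Prop :=
  forall i, locally_Lp Om p (fun x => F x 0 i).

Definition grad phi (x : vec) : vec := \row_i 'D_(delta_mx 0 i) phi x.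

(* C^1_0(Om): C^1 functions with compact support in Om, extended by 0. *)
Definition C1_0 Om phi : Prop :=
  [/\ forall x, differentiable phi x,
      forall i, continuous (fun x => grad phi x 0 i) &
      exists2 C, compact C /\ C `<=` Om & forall x, ~ C x -> phi x = 0].

Definition weak_gradient Om u (Du : vec -> vec) : Prop :=
  forall phi, C1_0 Om phi -> forall i,
    \int[leb]_(x in Om) (u x * grad phi x 0 i) =
    - \int[leb]_(x in Om) (Du x 0 i * phi x).

Definition W1p_loc Om (p : R) u (Du : vec -> vec) : Prop :=
  [/\ locally_Lp Om p u, locally_Lp_vec Om p Du & weak_gradient Om u Du].

(* The exponent q stands for the space L^{1,N/q}. When E is the whole space and
   0 < N, the condition on r reads 0 < r. *)
Definition morrey E (q : R) h : Prop :=
  leb.-integrable E (EFin \o h) /\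
  exists C : R, forall z r, E z -> 0 < r -> (r%:E <= diam E)%E ->
    (\int[leb]_(x in eball z r `&` E) `|h x|%:E
      <= (C * r `^ (N%:R - N%:R / q))%:E)%E.

Definition morrey_norm E (q : R) h : \bar R :=
  ereal_sup [set ((zr.2 `^ (N%:R / q - N%:R))%:E *
                  \int[leb]_(x in eball zr.1 zr.2 `&` E) `|h x|%:E)%E
            | zr in [set zr : vec * R |
                     [/\ E zr.1, 0 < zr.2 & (zr.2%:E <= diam E)%E]]].

Definition caratheodory_fun Om (A : vec -> R -> vec -> vec) : Prop :=
  (forall s xi, vmeasurable Om (fun x => A x s xi)) /\
  {ae leb, forall x, Om x -> forall i,
     continuous (fun sxi : R * vec => A x sxi.1 sxi.2 0 i)}.

(* u, with weak gradient Du, is a distributional supersolution of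
   - div A(x,u,Du) >= B(x,u,Du) in Om. *)
Definition supersolution Om (p : R) (A : vec -> R -> vec -> vec)
    (B : vec -> R -> vec -> R) u (Du : vec -> vec) : Prop :=
  [/\ W1p_loc Om p u Du,
      locally_Lp_vec Om (p / (p - 1)) (fun x => A x (u x) (Du x)),
      locally_Lp Om 1 (fun x => B x (u x) (Du x)) &
      forall phi, C1_0 Om phi -> (forall x, 0 <= phi x) ->
        \int[leb]_(x in Om) dotv (A x (u x) (Du x)) (grad phi x)
          >= \int[leb]_(x in Om) (B x (u x) (Du x) * phi x)].

End function_spaces.

(* Main.v *)
(* Test the supersolution inequality with phi = theta^k, theta being a cutoff
   between the balls of radii t and r with |grad theta| <= C / (r - t). Since
   |A . grad phi| <= nu |Du|^(p - 1) |grad phi|, Young's inequality absorbs this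
   term into c_H |Du|^gam phi at the cost of C (r - t)^(- gam / (gam - (p - 1))),
   provided k >= gam / (gam - (p - 1)). Splitting u = u^+ - u^-, what remains on
   the right is the integral over the ball of radius r of |f + lam u^+|, at most
   the Morrey norm times r^(N - N / q) <= r^N (r - t)^(- N / q). *)
Require Import Defs.
From HB Require Import structures.
From mathcomp Require Import all_boot all_order all_algebra.
From mathcomp Require Import all_classical all_reals all_analysis.
From mathcomp Require Import measurable_realfun lra ring.

Set Implicit Arguments.
Unset Strict Implicit.
Unset Printing Implicit Defensive.

Import Order.TTheory GRing.Theory Num.Theory.
Import numFieldNormedType.Exports.

Local Open Scope classical_set_scope.
Local Open Scope ring_scope.

(** The obstacle is integrability. [Du] is only locally in L^p while [gam] may exceed p, so the
    integral of |Du|^gam phi could be infinite a priori and cannot be subtracted from both sides of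
    the tested inequality. Absorption is therefore done pointwise: almost everywhere [G <= H1 + H2],
    where [G] collects the nonnegative terms to be estimated, [H1] is the integrand B phi - A . grad
    phi, whose integral is at most 0, and [H2] is |f + lam u^+| plus a constant. Only [H1] and [H2]
    have to be integrable; finiteness of the integral of [G] is part of the conclusion. Finiteness
    matters again wherever an extended real is read through [fine], which sends infinity to 0: the
    weak inequality is between real-valued integrals, and the constant takes the real part of a
    Morrey norm. Compact support of the cutoff settles the first case, the Morrey bounds on [Om] the
    second. *)

(** * Measurability of open and compact sets, from covers by boxes *)

Section lebesgue_measurability.
Context {R : realType} {N : nat}.
Local Notation vec := 'rV[R]_N.
Local Open Scope ereal_scope.

Lemma lebesgue_outer_obox (c : option (vec * vec)) :
  lebesgue_outer (obox c) <= vol c.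
Proof.
apply: (@le_trans _ _ (\sum_(k <oo) vol (if k == 0%N then c else None))).
  apply: ereal_inf_lbound; exists (fun k => if k == 0%N then c else None) => //=.
  by move=> x cx; exists 0%N.
rewrite nneseries_recl//; last by move=> k _; exact: vol_ge0.
rewrite eseries0 ?adde0//.
by case.
Qed.

(** The part below the hyperplane is again an open box. The part above contains its face x_i = m, so
    it is covered by an open box that starts at m - d instead; this costs at most d times the area
    [W] of the cross-section, which is below any given e. *)
Lemma lebesgue_outer_obox_split (c : option (vec * vec)) (i : 'I_N) (m : R) :
  lebesgue_outer (obox c `&` [set x | (x 0 i < m)%R]) +
  lebesgue_outer (obox c `&` ~` [set x | (x 0 i < m)%R]) <= vol c.
Proof.
case: c => [[a b]|]; last by rewrite /= !set0I outer_measure0 adde0.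
apply/lee_addgt0Pr => e e0.
pose W : R := (\prod_(j | j != i) Num.max 0 (b 0 j - a 0 j))%R.
have W0 : (0 <= W)%R by apply: prodr_ge0 => j _; rewrite le_max lexx.
(* [W + 1] rather than [W], since the cross-section may be degenerate. *)
pose d : R := (e / (W + 1))%R.
have d0 : (0 < d)%R by rewrite divr_gt0// ltr_wpDl.
pose bl : vec := \row_j (if j == i then Num.min (b 0 j) m else b 0 j)%R.
pose ar : vec := \row_j (if j == i then Num.max (a 0 j) (m - d) else a 0 j)%R.
apply: (@le_trans _ _ (vol (Some (a, bl)) + vol (Some (ar, b)))).
  apply: leeD; apply: le_trans (lebesgue_outer_obox _); apply: le_outer_measure.
    move=> x [/= xab xm] j; rewrite mxE; case: eqP => [->|_] //.
    by case/andP: (xab i) => -> xb /=; rewrite lt_min xb.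
  move=> x [/= xab /negP]; rewrite -leNgt => xm j; rewrite mxE.
  case: eqP => [->|_] //; case/andP: (xab i) => ax ->.
  by rewrite gt_max ax andbT /= (lt_le_trans _ xm)// ltrBlDr ltrDl.
rewrite /= -!EFinD lee_fin (bigD1 i)//= [X in (_ + X)%R](bigD1 i)//=.
rewrite [X in (_ <= X + _)%R](bigD1 i)//= !mxE eqxx.
have -> : (\prod_(j < N | j != i) Num.max 0 (bl 0 j - a 0 j) = W)%R.
  by apply: eq_bigr => j ji; rewrite mxE (negbTE ji).
have -> : (\prod_(j < N | j != i) Num.max 0 (b 0 j - ar 0 j) = W)%R.
  by apply: eq_bigr => j ji; rewrite mxE (negbTE ji).
rewrite -/W -mulrDl.
have dW : (d * W <= e)%R.
  by rewrite /d mulrAC ler_pdivrMr ?ltr_wpDl// ler_wpM2l ?lerDl// ltW.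
apply: le_trans (lerD (lexx _) dW); rewrite -mulrDl ler_wpM2r//.
(* What is left is one-dimensional: (min(b,m) - a)^+ + (b - max(a,m-d))^+ <= (b - a)^+ + d. *)
case: (leP (b 0 i)%R m) => bm; case: (leP (a 0 i)%R (m - d)%R) => am;
rewrite !maxEle; do ?case: ifPn; rewrite -?ltNge; lra.
Qed.

(** Carathéodory's criterion is checked cover by cover: cutting every box of a cover of [X] along
    the hyperplane covers both pieces of [X] at no greater total cost. *)
Lemma measurable_halfspace (i : 'I_N) (m : R) :
  measurable [set x : vec | (x 0 i < m)%R].
Proof.
apply: le_caratheodory_measurable => X.
apply: le_ereal_inf_tmp => _ [Q XQ <-].
set H := [set x | _].
have sub S : lebesgue_outer (X `&` S) <=
    \sum_(k <oo) lebesgue_outer (obox (Q k) `&` S).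
  apply: le_trans (outer_measure_sigma_subadditive _ _).
  apply: le_outer_measure => x [/XQ[k _ Qkx] Sx].
  by exists k.
apply: (le_trans (leeD (sub H) (sub (~` H)))).
rewrite -nneseriesD; do ?by move=> *; exact: outer_measure_ge0.
apply: lee_nneseries => k _ *; last exact: lebesgue_outer_obox_split.
by rewrite adde_ge0// outer_measure_ge0.
Qed.

Lemma measurable_coord (i : 'I_N) (D : set vec) :
  measurable_fun D (fun x : vec => x ord0 i).
Proof.
apply: measurable_funTS => /= mD.
apply: (measurability _ (RGenInftyO.measurableE R)) => //.
move=> /= _ [_ [x ->] <-]; rewrite setTI.
rewrite [X in measurable X](_ : _ = [set y : vec | (y ord0 i < x)%R]).
  exact: measurable_halfspace.
by apply/seteqP; split => y /=; rewrite in_itv.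
Qed.

Lemma measurable_obox (c : option (vec * vec)) : measurable (obox c).
Proof.
case: c => [[a b]|]; last exact: measurable0.
have -> : obox (Some (a, b)) =
    \bigcap_(i in [set: 'I_N]) (fun x : vec => x ord0 i) @^-1` `](a 0 i)%R, (b 0 i)%R[.
  apply/seteqP; split => x /= xab i; first by move=> _; rewrite /= in_itv; exact: xab.
  by have := xab i I; rewrite /= in_itv.
apply: fin_bigcap_measurable => // i _; rewrite -[X in measurable X]setTI.
exact: measurable_coord.
Qed.

(** An open set is the countable union of the boxes with rational corners inside it. Balls of the
    library norm are cubes, so such a box fits around each point; boxes that are not contained in
    [U] are replaced by [set0], so that the union runs over all pairs of rational vectors. *)
Lemma open_leb_measurable (U : set vec) : open U -> measurable U.
Proof.
move=> oU.
pose q2r (a : 'rV[rat]_N) : vec := map_mx ratr a.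
pose F (ab : 'rV[rat]_N * 'rV[rat]_N) :=
  if `[< obox (Some (q2r ab.1, q2r ab.2)) `<=` U >]
  then obox (Some (q2r ab.1, q2r ab.2)) else set0.
have -> : U = \bigcup_ab F ab; last first.
  apply: countable_bigcupT_measurable => // ab.
  by rewrite /F; case: ifP => _; [exact: measurable_obox|exact: measurable0].
apply/seteqP; split => [x Ux|x [ab _]]; last first.
  by rewrite /F; case: asboolP => // + ?; apply.
move: (oU _ Ux) => /nbhs_ballP[e /= e0 eU].
have /choice[a Ha] : forall i, exists q : rat, ratr q \in `](x 0 i - e)%R, (x 0 i)%R[.
  by move=> i; apply: rat_in_itvoo; rewrite ltrBlDr ltrDl.
have /choice[b Hb] : forall i, exists q : rat, ratr q \in `](x 0 i)%R, (x 0 i + e)%R[.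
  by move=> i; apply: rat_in_itvoo; rewrite ltrDl.
exists (\row_i a i, \row_i b i) => //; rewrite /F ifT; last first.
  apply/asboolP => y /= yab; apply: eU; split => // k i; rewrite (ord1 k).
  move: (yab i) (Ha i) (Hb i); rewrite /ball /= !mxE !in_itv /=.
  by move=> /andP[? ?] /andP[? ?] /andP[? ?]; rewrite ltr_norml; lra.
move=> i; rewrite !mxE.
by move: (Ha i) (Hb i); rewrite !in_itv /= => /andP[_ ->] /andP[->].
Qed.

Lemma closed_leb_measurable (C : set vec) : closed C -> measurable C.
Proof.
by move=> /closed_openC/open_leb_measurable/measurableC; rewrite setCK.
Qed.

Lemma compact_leb_measurable (C : set vec) : compact C -> measurable C.
Proof.
by move=> /(compact_closed (@norm_hausdorff _ _)); exact: closed_leb_measurable.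
Qed.

Lemma continuous_leb_measurable_fun (D : set vec) (h : vec -> R) :
  continuous h -> measurable_fun D h.
Proof.
move=> /continuousP ch; apply: measurable_funTS => /= mD.
apply: (measurability _ (RGenOpens.measurableE R)) => //.
move=> /= _ [_ [a [b ->] <-]]; rewrite setTI.
by apply: open_leb_measurable; apply: ch; exact: interval_open.
Qed.

End lebesgue_measurability.

(** * Euclidean norm, balls and diameter *)

Section euclidean_norm.
Context {R : realType} {N : nat}.
Local Notation vec := 'rV[R]_N.
Implicit Types x y z : vec.

Lemma dotv_ge0 x : 0 <= dotv x x.
Proof. by apply: sumr_ge0 => i _; rewrite -expr2 sqr_ge0. Qed.

Lemma enorm_ge0 x : 0 <= enorm x.
Proof. exact: sqrtr_ge0. Qed.

Lemma sqr_enorm x : enorm x ^+ 2 = dotv x x.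
Proof. by rewrite sqr_sqrtr// dotv_ge0. Qed.

Lemma enorm0 : enorm (0 : vec) = 0.
Proof.
by rewrite /enorm /dotv big1 ?sqrtr0// => i _; rewrite mxE mul0r.
Qed.

Lemma enormZ (a : R) x : enorm (a *: x) = `|a| * enorm x.
Proof.
rewrite /enorm -sqrtr_sqr -sqrtrM ?sqr_ge0//; congr Num.sqrt.
by rewrite /dotv mulr_sumr; apply: eq_bigr => i _; rewrite !mxE; ring.
Qed.

Lemma ler_coord_enorm x i : `|x 0 i| <= enorm x.
Proof.
rewrite -sqrtr_sqr ler_wsqrtr// /dotv (bigD1 i)//= -expr2 lerDl.
by apply: sumr_ge0 => j _; rewrite -expr2 sqr_ge0.
Qed.

Lemma enorm_eq0 x : enorm x = 0 -> x = 0.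
Proof.
move=> x0; apply/rowP => i; apply/eqP; rewrite mxE -normr_le0 -x0.
exact: ler_coord_enorm.
Qed.

(** Cauchy-Schwarz: the squared norm of |y| x - |x| y equals 2 |x| |y| (|x| |y| - x . y), and it is
    nonnegative. *)
Lemma dotv_le_enorm x y : dotv x y <= enorm x * enorm y.
Proof.
have [/enorm_eq0 ->|x0] := eqVneq (enorm x) 0.
  by rewrite enorm0 mul0r /dotv big1// => i _; rewrite mxE mul0r.
have [/enorm_eq0 ->|y0] := eqVneq (enorm y) 0.
  by rewrite enorm0 mulr0 /dotv big1// => i _; rewrite mxE mulr0.
have xy0 : 0 < enorm x * enorm y.
  by rewrite mulr_gt0// lt_neqAle eq_sym enorm_ge0 ?x0 ?y0.
have : 0 <= dotv (enorm y *: x - enorm x *: y) (enorm y *: x - enorm x *: y).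
  exact: dotv_ge0.
have -> : dotv (enorm y *: x - enorm x *: y) (enorm y *: x - enorm x *: y) =
    enorm y ^+ 2 * dotv x x + enorm x ^+ 2 * dotv y y
    - 2 * (enorm x * enorm y) * dotv x y.
  rewrite /dotv !mulr_sumr -big_split/= -sumrB; apply: eq_bigr => i _.
  by rewrite !mxE; ring.
rewrite -!sqr_enorm => h.
by rewrite -(ler_pM2l xy0); lra.
Qed.

Lemma is_derive_coord x v (i : 'I_N) :
  is_derive x v (fun y : vec => y 0 i) (v 0 i).
Proof.
have cv : h^-1 *: ((h *: v + x) 0 i - x 0 i) @[h --> 0^'] --> v 0 i.
  apply: cvg_near_cst; near=> h.
  rewrite !mxE addrK /GRing.scale /= mulKf//.
  by near: h; exact: nbhs_dnbhs_neq.
apply: DeriveDef; first by apply/cvg_ex; exists (v 0 i); exact: cv.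
by apply: cvg_lim => //; exact: cv.
Unshelve. all: by end_near. Qed.

Lemma dotv_subE z : (fun x => dotv (x - z) (x - z)) =
  \sum_(i < N) ((fun y : vec => y 0 i) - cst (z 0 i)) ^+ 2.
Proof.
apply/funext => x; rewrite fct_sumE; apply: eq_bigr => i _.
by rewrite !mxE -expr2 exprfctE.
Qed.

Lemma differentiable_dotv_sub z x :
  differentiable (fun x => dotv (x - z) (x - z)) x.
Proof.
rewrite dotv_subE; apply: differentiable_sum => i.
apply: differentiableX; apply: differentiableB => //.
exact: differentiable_coord.
Qed.

Lemma is_derive_dotv_sub z x (i : 'I_N) :
  is_derive x (delta_mx 0 i) (fun x => dotv (x - z) (x - z))
    (2 * (x 0 i - z 0 i)).
Proof.
rewrite dotv_subE.
apply: (@is_derive_eq _ _ _ _ _ _ _ (\sum_(j < N)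
    (2%:R * (((fun y : vec => y 0 j) - cst (z 0 j)) x) ^+ 1) *:
    ((delta_mx 0 i : vec) 0 j - 0))).
  apply: is_derive_sum => j; apply: is_deriveX; apply: is_deriveB.
  exact: is_derive_coord.
rewrite (bigD1 i)//= mxE !eqxx subr0 expr1 big1 ?addr0; last first.
  by move=> j ji; rewrite mxE (negbTE ji) subr0 scaler0.
by rewrite /GRing.scale /= mulr1.
Qed.

Lemma continuous_dotv_sub z : continuous (fun x => dotv (x - z) (x - z)).
Proof.
by move=> x; apply: differentiable_continuous; exact: differentiable_dotv_sub.
Qed.

Lemma continuous_enorm_sub z : continuous (fun x => enorm (x - z)).
Proof.
move=> x.
apply: (@continuous_comp _ _ _ (fun y => dotv (y - z) (y - z)) Num.sqrt).
  exact: continuous_dotv_sub.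
exact: sqrt_continuous.
Qed.

Lemma eball_open z (r : R) : open (eball z r).
Proof.
apply: (@open_comp _ _ (fun x => enorm (x - z)) [set y | y < r]).
  by move=> x _; exact: continuous_enorm_sub.
exact: open_lt.
Qed.

Lemma measurable_eball z (r : R) : measurable (eball z r).
Proof. exact/open_leb_measurable/eball_open. Qed.

Lemma eball_sub z (t r : R) : t <= r -> eball z t `<=` eball z r.
Proof. by move=> tr x /lt_le_trans; apply. Qed.

(** Comparison with the circumscribed cube; this is the origin of the factor [2 ^+ N] in the final
    constant. *)
Lemma leb_eball z (r : R) : 0 <= r -> (leb (eball z r) <= ((2 * r) ^+ N)%:E)%E.
Proof.
move=> r0.
pose c : option (vec * vec) :=
  Some (\row_i (z 0 i - r), \row_i (z 0 i + r)).
have -> : ((2 * r) ^+ N)%:E = vol c.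
  rewrite /= (eq_bigr (fun=> 2 * r)) ?prodr_const ?card_ord// => i _.
  by rewrite !mxE max_r; lra.
apply: le_trans (lebesgue_outer_obox _); apply: le_lebesgue_outer => x xz i.
rewrite !mxE; move: (le_lt_trans (ler_coord_enorm _ i) xz).
by rewrite !mxE ltr_norml; lra.
Qed.

Definition ecball z (r : R) : set vec := [set x | enorm (x - z) <= r].

Lemma ecball_compact z (r : R) : compact (ecball z r).
Proof.
apply: (@subclosed_compact _ _
  [set v : vec | forall i, `[z 0 i - r, z 0 i + r]%classic (v ord0 i)]).
- apply: (@closed_comp _ _ (fun x => enorm (x - z)) [set y | y <= r]).
    by move=> x _; exact: continuous_enorm_sub.
  exact: closed_le.
- apply: (@rV_compact R _ (fun i => `[z 0 i - r, z 0 i + r]%classic)) => i.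
  exact: segment_compact.
- move=> x xz i; rewrite /= in_itv /=; move: (le_trans (ler_coord_enorm _ i) xz).
  by rewrite !mxE ler_norml; lra.
Qed.

(** Makes [r] an admissible radius in the Morrey norm over the ball itself. Two opposite points at
    distance r / 2 from the center suffice. *)
Lemma le_diam_eball z (r : R) : (0 < N)%N -> 0 < r -> (r%:E <= diam (eball z r))%E.
Proof.
move=> N0 r0; pose e : vec := delta_mx 0 (Ordinal N0).
have e1 : enorm e = 1.
  rewrite /enorm /dotv (bigD1 (Ordinal N0))//= !mxE !eqxx mulr1 big1 ?addr0 ?sqrtr1//.
  by move=> j jN; rewrite !mxE (negbTE jN) mul0r.
apply: ereal_sup_ubound; exists (z + (r / 2) *: e, z - (r / 2) *: e) => /=.
  split; rewrite /eball /= addrAC subrr ?sub0r ?add0r.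
    by rewrite enormZ e1 mulr1 gtr0_norm; lra.
  by rewrite -scaleNr enormZ e1 mulr1 ltr0_norm; lra.
congr EFin.
have -> : z + (r / 2) *: e - (z - (r / 2) *: e) = r *: e.
  by apply/rowP => i; rewrite !mxE; lra.
by rewrite enormZ e1 mulr1 gtr0_norm.
Qed.

Lemma le_diam : {homo @diam R N : A B / A `<=` B >-> (A <= B)%E}.
Proof.
move=> A B AB; apply: ge_ereal_sup => _ [[x y] [Ax Ay] <-].
by apply: ereal_sup_ubound; exists (x, y) => //; split; exact: AB.
Qed.

End euclidean_norm.

(** * The C^1 cutoff and its gradient bound *)

Section cutoff.
Context {R : realType}.

Local Notation pos := (Num.max (0 : R)).

Lemma pos_ge0 (z : R) : 0 <= pos z.
Proof. by rewrite le_max lexx. Qed.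

Lemma continuous_pos : continuous (fun z : R => pos z).
Proof.
by move=> z; apply: continuous_max; [exact: cvg_cst|exact: cvg_id].
Qed.

(** The derivative 2 z^+ is 2-Lipschitz, hence the quadratic remainder. It yields the derivative at
    every z, including the kink of z^+ at 0. *)
Lemma sqr_pos_taylor (z h : R) :
  `|pos (z + h) ^+ 2 - pos z ^+ 2 - 2 * pos z * h| <= h ^+ 2.
Proof. by rewrite ler_norml !maxEle; do 2 case: ifPn; rewrite -?ltNge; nra. Qed.

Lemma is_derive_sqr_pos (z : R) :
  is_derive z 1 (fun y : R => pos y ^+ 2) (2 * pos z).
Proof.
have cv : h^-1 *: (pos (h *: 1 + z) ^+ 2 - pos z ^+ 2) @[h --> 0^'] --> 2 * pos z.
  apply/cvgrPdist_le => /= e e0; near=> h.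
  have h0 : h != 0 by near: h; exact: nbhs_dnbhs_neq.
  have hn0 : 0 < `|h| by rewrite normr_gt0.
  rewrite [h *: 1]mulr1 /GRing.scale /= (addrC h) distrC.
  have -> : h^-1 * (pos (z + h) ^+ 2 - pos z ^+ 2) - 2 * pos z =
    h^-1 * (pos (z + h) ^+ 2 - pos z ^+ 2 - 2 * pos z * h).
    by field.
  rewrite normrM normfV ler_pdivrMl// (le_trans (sqr_pos_taylor _ _))//.
  rewrite -real_normK ?num_real// expr2 ler_wpM2l//.
  near: h; apply: nbhs_dnbhs; apply/nbhs_ballP; exists e => // h.
  by rewrite /ball /= sub0r normrN => /ltW.
apply: DeriveDef; first by apply/cvg_ex; exists (2 * pos z); exact: cv.
by apply: cvg_lim => //; exact: cv.
Unshelve. all: by end_near. Qed.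

(** Differentiability and the directional derivative are returned together so that the chain rule
    can be iterated through the layers of the cutoff. *)
Lemma derive_comp (V : normedModType R) (g : R -> R) (W : V -> R) (x v : V)
    (dg dW : R) : differentiable W x -> is_derive x v W dW ->
  is_derive (W x) 1 g dg ->
  differentiable (g \o W) x /\ is_derive x v (g \o W) (dg * dW).
Proof.
move=> dfW dxW dxg.
have dfg : differentiable g (W x) by apply/derivable1_diffP; exact: ex_derive.
have dfgW : differentiable (g \o W) x by exact: differentiable_comp.
split=> //; apply: DeriveDef; first exact: diff_derivable.
rewrite deriveE// diff_comp//= diff1E// derive1E derive_val -deriveE// derive_val.
by rewrite /GRing.scale /= mulrC.
Qed.

Context {N : nat}.
Local Notation vec := 'rV[R]_N.

Lemma C1_0_sub (E F : set vec) (phi : vec -> R) :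
  E `<=` F -> C1_0 E phi -> C1_0 F phi.
Proof.
move=> EF [d c [C [cC CE] C0]]; split=> //; exists C => //.
by split=> //; exact: subset_trans EF.
Qed.

(* theta = (1 - ((V)^+)^2)^+ with V <= 0 on the small ball and V >= 1 outside the
   ball of radius rho. An even power of theta is a power of the C^1 function
   z |-> (z^+)^2 of 1 - ((V)^+)^2, hence C^1, and |grad theta^k| is controlled by
   theta^k.-1, which is what absorption_young needs. *)
Lemma cutoff_exists (x0 : vec) (t r : R) (j : nat) :
  (0 < N)%N -> 0 < t -> t < r ->
  exists theta : vec -> R,
    let k := j.+1.*2 in let phi x := theta x ^+ k in
    [/\ forall x, 0 <= theta x <= 1,
        forall x, eball x0 t x -> theta x = 1,
        forall x, ~ ecball x0 ((r + t) / 2) x -> theta x = 0,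
        C1_0 (eball x0 r) phi &
        forall x, enorm (grad phi x) <=
          8 * k%:R / (r - t) * theta x ^+ k.-1].
Proof.
move=> N0 t0 tr.
(* Since rho - t = (r - t) / 2, this [c] is at most rho^2 - t^2, so V <= 0 on the small ball. Being
   proportional to [rho], it also bounds |grad V| by 2 rho / c = 4 / (r - t) inside radius [rho].
   The factor 2 V^+ <= 2 in grad W then gives the 8 of the statement. *)
pose rho := (r + t) / 2; pose c := rho * (r - t) / 2.
have rt0 : 0 < r - t by rewrite subr_gt0.
have rho0 : 0 < rho by rewrite /rho; lra.
have trho : t < rho by rewrite /rho; lra.
have rhor : rho < r by rewrite /rho; lra.
have c0 : 0 < c by rewrite /c divr_gt0// mulr_gt0.
have tc : t ^+ 2 + c <= rho ^+ 2 by rewrite /c /rho; nra.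
pose S (x : vec) := dotv (x - x0) (x - x0).
pose V x := (S x - (rho ^+ 2 - c)) / c.
pose W x := 1 - pos (V x) ^+ 2.
pose theta x := pos (W x).
(* The chain rule gives grad phi = a(x) (x - x0). *)
pose a x := j.+1%:R * (theta x ^+ 2) ^+ j * (2 * theta x) *
  (- (2 * pos (V x)) * (c^-1 * 2)).
have W1 x : W x <= 1 by rewrite lerBlDr lerDl sqr_ge0.
have Sge0 x : 0 <= S x by exact: dotv_ge0.
have S_sqr x : S x = enorm (x - x0) ^+ 2 by rewrite sqr_enorm.
have th0 x : 0 <= theta x by exact: pos_ge0.
have th_rho x : rho <= enorm (x - x0) -> theta x = 0.
  move=> h; have S2 : rho ^+ 2 <= S x.
    by rewrite S_sqr ler_sqr ?nnegrE ?enorm_ge0// ltW.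
  have V1 : 1 <= V x by rewrite /V ler_pdivlMr// mul1r; lra.
  rewrite /theta max_l// subr_le0 max_r ?(le_trans _ V1)//.
  by rewrite exprn_ege1.
have cS : continuous S by exact: continuous_dotv_sub.
have cc (b : R) : continuous (fun _ : vec => b) by exact: cst_continuous.
have cM (f g : vec -> R) : continuous f -> continuous g ->
    continuous (fun x => f x * g x) by move=> cf cg x; exact: (continuousM (cf x) (cg x)).
have cB (f g : vec -> R) : continuous f -> continuous g ->
    continuous (fun x => f x - g x) by move=> cf cg x; exact: (continuousB (cf x) (cg x)).
have cX (f : vec -> R) m : continuous f -> continuous (fun x => f x ^+ m).
  move=> cf; elim: m => [|m ih]; first by under eq_fun do rewrite expr0; exact: cc.
  by under eq_fun do rewrite exprS; exact: cM.
have cpos (f : vec -> R) : continuous f -> continuous (fun x => pos (f x)).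
  by move=> cf x; apply: (@continuous_comp _ _ _ f pos);
    [exact: cf|exact: continuous_pos].
have cV : continuous V by apply/cM; [apply/cB|].
have cth : continuous theta by apply/cpos; apply/cB => //; apply/cX; exact: cpos.
have ca : continuous a.
  apply/cM; first by apply/cM; [apply/cM => //; do 2 apply/cX|apply/cM].
  apply/cM => //; under eq_fun do rewrite -sub0r.
  by apply/cB => //; apply/cM => //; exact/cpos.
pose phi x := theta x ^+ j.+1.*2.
have phiE : phi = (fun z => (pos z ^+ 2) ^+ j.+1) \o
    ((fun z => 1 - pos z ^+ 2) \o ((fun s => (s - (rho ^+ 2 - c)) / c) \o S)).
  by apply/funext => x /=; rewrite -exprM mul2n.
have dphi x i : differentiable phi x /\
    is_derive x (delta_mx 0 i) phi (a x * (x 0 i - x0 0 i)).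
  have dS := @differentiable_dotv_sub _ _ x0 x.
  have d0 (s : R) : is_derive s 1 (fun s => (s - (rho ^+ 2 - c)) / c) c^-1.
    rewrite (_ : (fun s => _) = c^-1 \*: (id - cst (rho ^+ 2 - c))); last first.
      by apply/funext => y /=; rewrite mulrC.
    by apply: is_derive_eq; rewrite subr0 [LHS]mulr1.
  have d1 (z : R) : is_derive z 1 (fun z => 1 - pos z ^+ 2) (- (2 * pos z)).
    rewrite -sub0r; apply: is_deriveB; exact: is_derive_sqr_pos.
  have d2 (z : R) : is_derive z 1 (fun z => (pos z ^+ 2) ^+ j.+1)
      (j.+1%:R * (pos z ^+ 2) ^+ j * (2 * pos z)).
    rewrite (_ : (fun z => _) = (fun z => pos z ^+ 2) ^+ j.+1); last first.
      by apply/funext => y; rewrite exprfctE.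
    exact: (is_deriveX j.+1 (is_derive_sqr_pos z)).
  have [dV xV] := derive_comp dS (is_derive_dotv_sub x0 x i) (d0 (S x)).
  have [dW xW] := derive_comp dV xV (d1 _).
  have [dP xP] := derive_comp dW xW (d2 _).
  rewrite phiE; split=> //; apply: is_derive_eq xP _.
  by rewrite /a /theta /W /V /=; ring.
have gphi x : grad phi x = a x *: (x - x0).
  by apply/rowP => i; rewrite !mxE; have [_ /@derive_val ->] := dphi x i.
exists theta => /=; split.
- by move=> x; rewrite th0 /= /theta ge_max ler01 W1.
- move=> x xt; have S2 : S x < t ^+ 2.
    by rewrite S_sqr ltr_sqr ?nnegrE ?enorm_ge0// ltW.
  have V0 : V x <= 0 by rewrite /V pmulr_lle0 ?invr_gt0//; lra.
  by rewrite /theta /W (max_l V0) expr0n subr0 max_r.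
- by move=> x /negP; rewrite -ltNge => /ltW; exact: th_rho.
- split.
  + by move=> x; have [] := dphi x (Ordinal N0).
  + move=> i.
    have -> : (fun x => grad phi x 0 i) = (fun x => a x * (x 0 i - x0 0 i)).
      by apply/funext => x; rewrite gphi !mxE.
    by apply/cM => //; apply/cB => //; exact: coord_continuous.
  + exists (ecball x0 rho).
      by split; [exact: ecball_compact|move=> x /le_lt_trans; apply].
    move=> x /negP; rewrite -ltNge => /ltW/th_rho ->.
    by rewrite expr0n.
- move=> x; rewrite gphi enormZ.
  (* Far from [x0] the factor |x - x0| is unbounded, but [theta] vanishes there and [a] with it. *)
  have [xrho|xrho] := leP rho (enorm (x - x0)).
    by rewrite /a th_rho// !(mulr0, mul0r) normr0 mul0r expr0n mulr0.
  have V1 : V x <= 1.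
    have : S x < rho ^+ 2 by rewrite S_sqr ltr_sqr ?nnegrE ?enorm_ge0// ltW.
    by rewrite /V ler_pdivrMr// mul1r; lra.
  have pV1 : pos (V x) <= 1 by rewrite ge_max ler01.
  have -> : `|a x| = j.+1.*2%:R * theta x ^+ j.*2.+1 * (4 / c) * pos (V x).
    have -> : a x = - (j.+1.*2%:R * theta x ^+ j.*2.+1 * (4 / c) * pos (V x)).
      rewrite /a -exprM mul2n exprSr -[j.+1.*2]muln2 natrM; ring.
    rewrite normrN ger0_norm// !mulr_ge0 ?exprn_ge0 ?invr_ge0 ?pos_ge0//.
    exact: ltW.
  have -> : 8 * j.+1.*2%:R / (r - t) * theta x ^+ (j.+1.*2).-1 =
      j.+1.*2%:R * theta x ^+ j.*2.+1 * (4 / c) * rho.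
    by rewrite /c; field; rewrite !gt_eqF.
  rewrite -[leLHS]mulrA ler_wpM2l//.
    by rewrite !mulr_ge0 ?exprn_ge0 ?invr_ge0// ltW.
  by rewrite -[leRHS]mul1r ler_pM ?pos_ge0 ?enorm_ge0// ltW.
Qed.
End cutoff.

(* A weighted Young inequality for the conjugate exponents (a + b) / b and
   (a + b) / a; the power k on the left suffices because b / a <= k. *)
Lemma absorption_young (R : realType) (a b kap M D th : R) (k : nat) :
  0 < a -> 0 < b -> 0 < kap -> 0 <= M -> 0 <= D -> 0 <= th <= 1 ->
  b / a <= k%:R ->
  M * D `^ b * th ^+ k <=
    kap * D `^ (a + b) * th ^+ k.+1 + M * (M / kap) `^ (b / a).
Proof.
move=> a0 b0 kap0 M0 D0 /andP[th0 th1] bak.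
have k0 : (0 < k)%N by rewrite -(ltr_nat R) (lt_le_trans _ bak)// divr_gt0.
have DE : D `^ (a + b) = D `^ a * D `^ b.
  by rewrite powRD// gt_eqF// addr_gt0.
(* Either the factor [M] is dominated by kap D^a th, and the first term on the right suffices, or
   D^a th < M / kap; raising this to the power b / a and using th^k <= th^(b/a) leaves the constant
   term. *)
have [h|h] := leP M (kap * (D `^ a * th)).
  apply: (@le_trans _ _ (kap * D `^ (a + b) * th ^+ k.+1)); last first.
    by rewrite lerDl mulr_ge0// powR_ge0.
  have -> : kap * D `^ (a + b) * th ^+ k.+1 =
      (kap * (D `^ a * th)) * (D `^ b * th ^+ k) by rewrite DE exprS; ring.
  by rewrite -mulrA ler_wpM2r// mulr_ge0 ?powR_ge0 ?exprn_ge0.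
apply: (@le_trans _ _ (M * (M / kap) `^ (b / a))); last first.
  by rewrite lerDr !mulr_ge0 ?powR_ge0 ?exprn_ge0// ltW.
rewrite -mulrA ler_wpM2l//.
apply: (@le_trans _ _ ((D `^ a * th) `^ (b / a))); last first.
  rewrite ge0_ler_powR ?nnegrE ?divr_ge0 ?mulr_ge0 ?powR_ge0//; try exact: ltW.
  by rewrite ler_pdivlMr// mulrC ltW.
have abK : a * (b / a) = b by rewrite mulrCA divff ?mulr1// gt_eqF.
rewrite powRM ?powR_ge0// -powRrM abK.
rewrite ler_wpM2l ?powR_ge0//.
have [->|thn0] := eqVneq th 0; first by rewrite expr0n gtn_eqF// powR_ge0.
rewrite -powR_mulrn//; apply: ger_powR => //.
by rewrite th1 andbT lt_neqAle eq_sym thn0.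
Qed.

(** Brings different negative powers of r - t to the common exponent [s]: X^(-e) = X^(s-e) / X^s,
    and X^(s-e) is increasing in X. This is how the upper bound [delta] enters the constant. *)
Lemma powRN_le_scale (R : realType) (X d e s : R) :
  0 < X -> X <= d -> e <= s -> X `^ (- e) <= d `^ (s - e) / X `^ s.
Proof.
move=> X0 Xd es; rewrite ler_pdivlMr ?powR_gt0// -powRD;
  last by rewrite (gt_eqF X0) implybT.
rewrite addrC ge0_ler_powR ?nnegrE ?subr_ge0//; first exact: ltW.
exact: le_trans (ltW X0) Xd.
Qed.

(** * Integrability, the tested inequality and the absorption *)

Section energy.
Context {R : realType} {N : nat}.
Local Notation vec := 'rV[R]_N.

Lemma integral_support (C S : set vec) (g : vec -> \bar R) :
  C `<=` S -> (forall x, ~ C x -> g x = 0%E) ->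
  (\int[leb]_(x in S) g x = \int[leb]_(x in C) g x)%E.
Proof.
move=> CS g0; rewrite integral_mkcond [RHS]integral_mkcond.
apply: eq_integral => x _; rewrite /patch.
case: ifPn => [|/negP xS]; case: ifPn => [|/negP xC] //.
  by move=> _; apply: g0; move: xC; rewrite inE.
by rewrite !inE in xS * => /CS/xS.
Qed.

Lemma integrable_cst_fin (D : set vec) (b : R) :
  measurable D -> (leb D < +oo)%E -> leb.-integrable D (EFin \o cst b).
Proof.
move=> mD Doo; apply/integrableP; split; first exact/measurable_EFinP.
by rewrite /= integral_cst// lte_mul_pinfty.
Qed.

(** On the compact [C], of finite measure, |h psi| <= M (1 + |h|^s); outside it the product
    vanishes. It serves B with s = 1 and the components of A with s = p / (p - 1). *)
Lemma locally_Lp_mul_integrable (Om S C : set vec) (s M : R) (h psi : vec -> R) :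
  measurable Om -> measurable S -> (leb C < +oo)%E ->
  1 <= s -> locally_Lp Om s h -> continuous psi ->
  (forall x, `|psi x| <= M) -> (forall x, ~ C x -> psi x = 0) ->
  compact C -> C `<=` S -> S `<=` Om ->
  leb.-integrable S (EFin \o (fun x => h x * psi x)).
Proof.
move=> mOm mS Coo s1 [mh hfin] cpsi psiM psi0 cC CS SOm.
have mC := compact_leb_measurable cC.
have mhp D : measurable D -> D `<=` Om -> measurable_fun D (fun x => h x * psi x).
  move=> mD DOm; apply: measurable_funM.
    exact: (measurable_funS mOm DOm mh).
  exact: continuous_leb_measurable_fun.
have COm : C `<=` Om by exact: subset_trans SOm.
have mhC : measurable_fun C h by exact: (measurable_funS mOm COm mh).
have ih : leb.-integrable C (EFin \o (fun x => `|h x| `^ s)).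
  apply/integrableP; split.
    apply/measurable_EFinP; apply: (measurableT_comp (measurable_powR s)).
    exact: measurableT_comp.
  under eq_integral do rewrite /= ger0_norm ?powR_ge0//.
  exact: hfin.
have i1 : leb.-integrable C (EFin \o (fun x => M * (1 + `|h x| `^ s))).
  have -> : EFin \o (fun x => M * (1 + `|h x| `^ s)) = (fun x => M%:E *
      ((EFin \o cst 1%R) \+ (EFin \o (fun x => `|h x| `^ s)%R)) x)%E.
    by apply/funext => x /=; rewrite EFinM EFinD.
  apply: integrableZl => //; apply: integrableD => //.
  exact: integrable_cst_fin.
have i2 : leb.-integrable C (EFin \o (fun x => h x * psi x)).
  apply: le_integrable i1 => //; first by apply/measurable_EFinP; exact: mhp.
  move=> x Cx; rewrite /= lee_fin normrM.
  have M0 : 0 <= M by apply: le_trans (psiM x).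
  rewrite [leRHS]ger0_norm ?mulr_ge0 ?addr_ge0 ?powR_ge0//.
  rewrite mulrC ler_pM//.
  have [h1|h1] := leP `|h x| 1; first by rewrite (le_trans h1)// lerDl powR_ge0.
  apply: (@le_trans _ _ (`|h x| `^ s)); last by rewrite lerDr.
  by rewrite -[leLHS]powRr1// ler_powR// ltW.
apply/integrableP; split; first by apply/measurable_EFinP; exact: mhp.
rewrite (integral_support CS); first by case/integrableP: i2.
by move=> x /psi0 /= ->; rewrite mulr0 normr0.
Qed.

(** The ball itself, with its own center and radius, is one of the competitors in the supremum that
    defines the norm. *)
Lemma integral_le_morrey_norm (Om : set vec) (q r : R) (f g : vec -> R) (x0 : vec) :
  (0 < N)%N -> 0 < r -> measurable Om -> eball x0 r `<=` Om ->
  morrey Om q f -> morrey Om q g ->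
  (\int[leb]_(x in eball x0 r) `|f x + g x|%:E <=
    (fine (morrey_norm (eball x0 r) q (fun x => f x + g x)%R)
     * r `^ (N%:R - N%:R / q))%:E)%E.
Proof.
move=> N0 r0 mOm SOm [fi [Cf Hf]] [gi [Cg Hg]].
set nrm := morrey_norm _ _ _.
have mS := measurable_eball x0 r.
have mf : measurable_fun Om f by apply/measurable_EFinP; exact: measurable_int fi.
have mg : measurable_fun Om g by apply/measurable_EFinP; exact: measurable_int gi.
(* Finiteness of the norm: radii admissible for the ball are admissible for [Om], so the Morrey
   constants of [f] and [g] on [Om] add up to a bound. *)
have ub : (nrm <= (Cf + Cg)%:E)%E.
  apply: ge_ereal_sup => _ [[z e] /= [Sz e0 ed] <-].
  have mB := measurable_eball z e.
  have mBO : measurable (eball z e `&` Om) by exact: measurableI.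
  have BO := @subIsetr _ (eball z e) Om.
  have mfB := measurable_funS mOm BO mf.
  have mgB := measurable_funS mOm BO mg.
  have edO : (e%:E <= diam Om)%E := le_trans ed (le_diam SOm).
  have I1 : (\int[leb]_(x in eball z e `&` eball x0 r) `|f x + g x|%:E <=
      ((Cf + Cg) * e `^ (N%:R - N%:R / q))%:E)%E.
    have mfg : measurable_fun (eball z e `&` Om) (fun x => `|f x + g x|%:E).
      apply/measurable_EFinP; apply: (measurableT_comp (@normr_measurable R setT)).
      exact: (measurable_funD mfB mgB).
    have maf : measurable_fun (eball z e `&` Om) (fun x => `|f x|%:E).
      by apply/measurable_EFinP; exact: (measurableT_comp (@normr_measurable R setT) mfB).
    have mag : measurable_fun (eball z e `&` Om) (fun x => `|g x|%:E).
      by apply/measurable_EFinP; exact: (measurableT_comp (@normr_measurable R setT) mgB).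
    have ge0 (h : vec -> R) x : (eball z e `&` Om) x -> (0 <= `|h x|%:E)%E.
      by move=> _; rewrite lee_fin.
    have sub : eball z e `&` eball x0 r `<=` eball z e `&` Om by exact: setIS.
    apply: (le_trans (ge0_subset_integral _ (measurableI _ _ mB mS) mBO mfg
      (ge0 (fun x => f x + g x)) sub)).
    apply: (@le_trans _ _ (\int[leb]_(x in eball z e `&` Om) (`|f x|%:E + `|g x|%:E))%E).
      apply: (ge0_le_integral _ mBO (ge0 (fun x => f x + g x)) mfg
        (emeasurable_funD maf mag)) => x _.
      by rewrite -EFinD lee_fin ler_normD.
    rewrite (ge0_integralD _ mBO (ge0 f) maf (ge0 g) mag).
    by rewrite mulrDl EFinD leeD ?Hf ?Hg//; exact: SOm.
  apply: (le_trans (lee_wpmul2l _ I1)); first by rewrite lee_fin powR_ge0.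
  rewrite -EFinM lee_fin mulrCA -powRD; last by rewrite (gt_eqF e0) implybT.
  by rewrite addrA subrK subrr powRr0 mulr1.
have lb : ((r `^ (N%:R / q - N%:R))%:E *
    \int[leb]_(x in eball x0 r) `|f x + g x|%:E <= nrm)%E.
  apply: ereal_sup_ubound; exists (x0, r) => /=; last by rewrite setIid.
  split=> //; last exact: le_diam_eball.
  by rewrite /eball /= subrr enorm0.
have i0 : (0 <= \int[leb]_(x in eball x0 r) `|f x + g x|%:E)%E.
  by apply: integral_ge0 => x _; rewrite lee_fin.
have nfin : nrm \is a fin_num.
  rewrite fin_numElt (le_lt_trans ub) ?ltry// andbT (lt_le_trans _ lb)//.
  by rewrite (lt_le_trans (ltNyr 0))// mule_ge0// lee_fin powR_ge0.
have : ((r `^ (N%:R - N%:R / q))%:E * ((r `^ (N%:R / q - N%:R))%:E *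
    \int[leb]_(x in eball x0 r) `|f x + g x|%:E) <=
    (r `^ (N%:R - N%:R / q))%:E * (fine nrm)%:E)%E.
  by apply: lee_wpmul2l; rewrite ?lee_fin ?powR_ge0// fineK.
rewrite muleA -!EFinM -powRD; last by rewrite (gt_eqF r0) implybT.
by rewrite addrA subrK subrr powRr0 mul1e [X in (_ <= X%:E)%E -> _]mulrC.
Qed.

Lemma measurable_enorm (D : set vec) (F : vec -> vec) :
  vmeasurable D F -> measurable_fun D (fun x => enorm (F x)).
Proof.
move=> mF; apply: (measurableT_comp (continuous_measurable_fun (@sqrt_continuous R))).
by apply: measurable_sum => i; apply: measurable_funM; exact: mF.
Qed.

(** [G] need not be integrable beforehand. As 0 <= G <= H1 + H2 almost everywhere, the sum agrees
    almost everywhere with its positive part, so a comparison of nonnegative functions is enough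
    before splitting the integral. *)
Lemma ae_le_add_integral (S : set vec) (G H1 H2 : vec -> R) :
  measurable S -> measurable_fun S G -> (forall x, S x -> 0 <= G x) ->
  leb.-integrable S (EFin \o H1) -> leb.-integrable S (EFin \o H2) ->
  (\int[leb]_(x in S) (H1 x)%:E <= 0)%E ->
  {ae leb, forall x, S x -> G x <= H1 x + H2 x} ->
  (\int[leb]_(x in S) (G x)%:E <= \int[leb]_(x in S) (H2 x)%:E)%E.
Proof.
move=> mS mG G0 i1 i2 H10 Gle.
pose H x := H1 x + H2 x.
have iH : leb.-integrable S (EFin \o H) by exact: (integrableD mS i1 i2).
have mH : measurable_fun S H by apply/measurable_EFinP; exact: measurable_int iH.
have mHp : measurable_fun S (EFin \o H^\+)
  by apply/measurable_EFinP; exact: measurable_funrpos.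
apply: (@le_trans _ _ (\int[leb]_(x in S) ((H^\+ x)%:E))%E).
  apply: (ae_ge0_le_integral mS _ _ _ mHp).
  - by move=> x Sx; rewrite lee_fin G0.
  - exact/measurable_EFinP.
  - by move=> x _; rewrite lee_fin funrpos_ge0.
  - by apply: filterS Gle => x GH Sx; rewrite lee_fin /funrpos le_max GH.
have -> : (\int[leb]_(x in S) (H^\+ x)%:E = \int[leb]_(x in S) (H x)%:E)%E.
  apply: (ae_eq_integral (EFin \o H) _ mS mHp); first exact: measurable_int iH.
  apply: filterS Gle => x GH Sx; congr EFin; rewrite /funrpos /H max_l//.
  exact: le_trans (G0 _ Sx) (GH Sx).
have -> : (\int[leb]_(x in S) (H x)%:E =
    \int[leb]_(x in S) (H1 x)%:E + \int[leb]_(x in S) (H2 x)%:E)%E.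
  exact: (integralD_EFin mS i1 i2).
by rewrite -[leRHS]add0e leeD2r.
Qed.

(** The weak inequality compares real parts of integrals over [Om]. Vanishing outside [C] moves both
    integrals to [S], and integrability there allows [fine] to be removed. *)
Lemma supersolution_test_le0 (Om S C : set vec) (p L : R)
    (A : vec -> R -> vec -> vec) (B : vec -> R -> vec -> R) (u : vec -> R)
    (Du : vec -> vec) (phi : vec -> R) :
  1 < p -> open Om -> measurable S -> (leb C < +oo)%E ->
  compact C -> C `<=` S -> S `<=` Om ->
  supersolution Om p A B u Du ->
  C1_0 Om phi -> (forall x, ~ C x -> phi x = 0) ->
  (forall x, ~ C x -> grad phi x = 0) ->
  (forall x, 0 <= phi x <= 1) -> (forall x, enorm (grad phi x) <= L) ->
  let H x := B x (u x) (Du x) * phi x - dotv (A x (u x) (Du x)) (grad phi x) in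
  leb.-integrable S (EFin \o H) /\ (\int[leb]_(x in S) (H x)%:E <= 0)%E.
Proof.
move=> p1 oOm mS Coo cC CS SOm [_ LA LB ss] C1phi phi0 gphi0 phi01 gL H.
have mOm := open_leb_measurable oOm.
have iB : leb.-integrable S (EFin \o (fun x => B x (u x) (Du x) * phi x)).
  apply: (@locally_Lp_mul_integrable Om S C 1 1) => //.
    by move=> x; apply: differentiable_continuous; case: C1phi.
  by move=> x; have /andP[? ?] := phi01 x; rewrite ger0_norm.
have iA : leb.-integrable S
    (EFin \o (fun x => dotv (A x (u x) (Du x)) (grad phi x))).
  have -> : EFin \o (fun x => dotv (A x (u x) (Du x)) (grad phi x)) =
      (fun x => \sum_(i < N) (A x (u x) (Du x) 0 i * grad phi x 0 i)%:E)%E.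
    by apply/funext => x; rewrite sumEFin.
  apply: integrable_sum => // i _.
  apply: (@locally_Lp_mul_integrable Om S C (p / (p - 1)) L) => //.
  - by rewrite ler_pdivlMr ?subr_gt0// mul1r lerBlDr lerDl.
  - by case: C1phi.
  - by move=> x; exact: le_trans (ler_coord_enorm _ _) (gL x).
  - by move=> x /gphi0 ->; rewrite mxE.
split.
  exact: (integrableB mS iB iA).
have -> : (\int[leb]_(x in S) (H x)%:E =
  \int[leb]_(x in S) (B x (u x) (Du x) * phi x)%:E
  - \int[leb]_(x in S) (dotv (A x (u x) (Du x)) (grad phi x))%:E)%E.
  exact: (integralB_EFin mS iB iA).
have COm := subset_trans CS SOm.
have := ss phi C1phi (fun x => proj1 (andP (phi01 x))).
rewrite /Rintegral.
rewrite (integral_support COm) => [|x /phi0 ->]; last by rewrite mulr0.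
rewrite (integral_support COm) => [|x /gphi0 ->]; last first.
  by congr EFin; rewrite /dotv big1// => i _; rewrite mxE mulr0.
rewrite -(integral_support CS) => [|x /phi0 ->]; last by rewrite mulr0.
rewrite -(integral_support CS) => [|x /gphi0 ->]; last first.
  by congr EFin; rewrite /dotv big1// => i _; rewrite mxE mulr0.
have fB := integrable_fin_num mS iB.
have fA := integrable_fin_num mS iA.
by rewrite -lee_fin !fineK// => h; rewrite sube_le0.
Qed.

(** Cauchy-Schwarz bounds A . g by nu L D^b th^k, and Young's inequality with M = nu L absorbs it
    into one of the two copies of kap D^(a+b); the other copy survives on the left. The exponent [k]
    is one less than that of the cutoff. *)
Lemma pointwise_absorption (a b kap nu L lam f D up um y th : R) (k : nat)
    (A g : vec) (B : R) :
  0 < a -> 0 < b -> 0 < kap -> 0 <= nu -> 0 <= L -> 0 <= D -> 0 <= th <= 1 ->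
  b / a <= k%:R ->
  enorm A <= nu * D `^ b -> enorm g <= L * th ^+ k ->
  2 * kap * D `^ (a + b) - lam * (up - um) - f <= B ->
  kap * D `^ (a + b) * th ^+ k.+1 + lam * um * th ^+ k.+1 <=
  B * th ^+ k.+1 - dotv A g + (`|f + lam * up| + nu * L * (nu * L / kap) `^ (b / a)).
Proof.
move=> a0 b0 kap0 nu0 L0 D0 th01 bak HA Hg HB; set phi := th ^+ k.+1.
have [th0 th1] := andP th01.
have phi0 : 0 <= phi by exact: exprn_ge0.
have phi1 : phi <= 1 by exact: exprn_ile1.
have nuL0 : 0 <= nu * L by exact: mulr_ge0.
have Y := absorption_young a0 b0 kap0 nuL0 D0 th01 bak.
have HAg : dotv A g <= nu * L * D `^ b * th ^+ k.
  apply: (le_trans (dotv_le_enorm _ _)).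
  have -> : nu * L * D `^ b * th ^+ k = (nu * D `^ b) * (L * th ^+ k) by ring.
  by rewrite ler_pM ?enorm_ge0.
have HBphi := ler_wpM2r phi0 HB.
have HF : (f + lam * up) * phi <= `|f + lam * up|.
  apply: (@le_trans _ _ (`|f + lam * up| * phi)).
    by rewrite ler_wpM2r// ler_norm.
  by rewrite -[leRHS]mulr1 ler_wpM2l.
rewrite -/phi in Y; lra.
Qed.

End energy.

(* K depends on p, gam, nu, cH, q, N, on an upper bound delta of r - t and, as a
   function, on the Morrey norm over the ball of radius r. The argument delta is
   arbitrary, so every pair of concentric balls is covered; K cannot be chosen
   uniformly as r - t tends to infinity unless N / q = gam / (gam - (p - 1)),
   because the two exponents in the maximum come from terms that scale
   differently. *)
Theorem lemma2p3 (R : realType) (N : nat) (p gam nu cH q delta : R)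
    (N_gt1 : (1 < N)%N) (p_gt1 : 1 < p) (gam_gt : p - 1 < gam)
    (nu_gt0 : 0 < nu) (cH_gt0 : 0 < cH) (q_ge1 : 1 <= q) :
  exists K : R -> R,
    forall (Om : set 'rV[R]_N) (lam : R) (f : 'rV[R]_N -> R)
      (A : 'rV[R]_N -> R -> 'rV[R]_N -> 'rV[R]_N)
      (B1 : 'rV[R]_N -> R -> 'rV[R]_N -> R)
      (u : 'rV[R]_N -> R) (Du : 'rV[R]_N -> 'rV[R]_N),
    open Om -> bounded_set Om \/ Om = setT ->
    0 <= lam -> morrey Om q f ->
    caratheodory_fun Om A ->
    {ae leb, forall x, Om x -> forall s xi,
       enorm (A x s xi) <= nu * enorm xi `^ (p - 1)} ->
    {ae leb, forall x, Om x -> forall s xi,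
       cH * enorm xi `^ gam - lam * s - f x <= B1 x s xi} ->
    supersolution Om p A B1 u Du ->
    morrey Om q (fun x => lam * u^\+ x) ->
    forall (x0 : 'rV[R]_N) (t r : R),
      0 < t -> t < r -> r - t <= delta -> eball x0 r `<=` Om ->
      (\int[leb]_(x in eball x0 t) (enorm (Du x) `^ gam)%:E
         + lam%:E * \int[leb]_(x in eball x0 t) (u^\- x)%:E
       <= (K (fine (morrey_norm (eball x0 r) q (fun x => f x + lam * u^\+ x)))
           * (r ^+ N / (r - t) `^ Num.max (N%:R / q) (gam / (gam - (p - 1)))))%:E)%E.
Proof.
have N0 : (0 < N)%N by exact: ltn_trans N_gt1.
pose a := gam - (p - 1); pose b := p - 1; pose kap := cH / 2.
have a0 : 0 < a by rewrite subr_gt0.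
have b0 : 0 < b by rewrite subr_gt0.
have abE : gam = a + b by rewrite /a /b; lra.
have kap0 : 0 < kap by rewrite divr_gt0.
(* The exponent [k] must be even for the cutoff and satisfy b / a <= k - 1 for Young's inequality;
   here k - 1 = 2j + 1 >= j + 1 > b / a. *)
pose j := Num.truncn (b / a); pose k := j.+1.*2.
have bak : b / a <= k.-1%:R.
  apply: (@le_trans _ _ j.+1%:R).
    by rewrite ltW// truncnS_gt.
  by rewrite ler_nat /k doubleS /= ltnS -addnn leq_addr.
pose s := Num.max (N%:R / q) (gam / a).
(* The gradient term keeps the coefficient [kap] and the u^- term the coefficient 1, so [m] factors
   out of both. *)
pose m := Num.min kap 1.
have m0 : 0 < m by rewrite lt_min kap0 ltr01.
pose c1 : R := 8 * k%:R.
have c10 : 0 < c1 by rewrite mulr_gt0// ltr0n.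
(* The Young constant [C1] below, normalized to r - t = 1. *)
pose C2 := nu * c1 * (nu * c1 / kap) `^ (b / a).
have C20 : 0 <= C2 by rewrite mulr_ge0 ?powR_ge0// mulr_ge0// ltW.
exists (fun M => m^-1 * (`|M| * delta `^ (s - N%:R / q) +
                         C2 * 2 ^+ N * delta `^ (s - gam / a))).
move=> Om lam f A B1 u Du oOm _ lam0 mof _ Anu Bge ss mou x0 t r t0 tr rd SOm.
rewrite -/s; set F := fun x => f x + lam * u^\+ x.
set M := fine _.
pose S := eball x0 r; pose T := eball x0 t.
have rt0 : 0 < r - t by rewrite subr_gt0.
have r0 : 0 < r by exact: lt_trans tr.
pose L := c1 / (r - t).
have L0 : 0 < L by rewrite divr_gt0.
have mOm := open_leb_measurable oOm.
have mS : measurable S by exact: measurable_eball.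
have mT : measurable T by exact: measurable_eball.
have TS : T `<=` S by apply: eball_sub; exact: ltW.
have [th [th01 th1 thC C1phi gL]] := cutoff_exists x0 j N0 t0 tr.
rewrite -/k in C1phi gL.
pose C := ecball x0 ((r + t) / 2).
have CS : C `<=` S by move=> x /le_lt_trans; apply; lra.
have cC : compact C by exact: ecball_compact.
have mC := compact_leb_measurable cC.
have lS : (leb S <= ((2 * r) ^+ N)%:E)%E by apply: leb_eball; exact: ltW.
have Soo : (leb S < +oo)%E by apply: le_lt_trans lS _; exact: ltry.
have Coo : (leb C < +oo)%E.
  by apply: le_lt_trans Soo; apply: le_measure => //; rewrite inE.
pose phi x := th x ^+ k.
have th0 x : 0 <= th x by case/andP: (th01 x).
have phi01 x : 0 <= phi x <= 1.
  by case/andP: (th01 x) => ? ?; rewrite exprn_ge0//= exprn_ile1.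
have gL' x : enorm (grad phi x) <= L.
  apply: (le_trans (gL x)); rewrite -/c1 -/L -[leRHS]mulr1 ler_wpM2l//; first exact: ltW.
  by case/andP: (th01 x) => ? ?; rewrite exprn_ile1.
have phiC x : ~ C x -> phi x = 0 by move=> /thC thx; rewrite /phi thx expr0n.
have gphiC x : ~ C x -> grad phi x = 0.
  move=> /thC thx; apply: enorm_eq0; apply/eqP; rewrite eq_le enorm_ge0 andbT.
  by rewrite (le_trans (gL x))// thx expr0n mulr0.
have [iH1 H1le0] := supersolution_test_le0 p_gt1 oOm mS Coo cC CS SOm ss
  (C1_0_sub SOm C1phi) phiC gphiC phi01 gL'.
set H1 := fun x => _ - _ in iH1 H1le0.
pose C1 := nu * L * (nu * L / kap) `^ (b / a).
have C10 : 0 <= C1 by rewrite mulr_ge0 ?powR_ge0// mulr_ge0// ltW.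
have iF : leb.-integrable S (EFin \o (fun x => `|F x|)).
  have [fi _] := mof; have [ui _] := mou.
  apply: (@integrable_norm _ _ _ _ _ F).
  exact: (integrableD mS (integrableS mOm mS SOm fi) (integrableS mOm mS SOm ui)).
have iC1 := integrable_cst_fin C1 mS Soo.
pose H2 x := `|F x| + C1.
have iH2 : leb.-integrable S (EFin \o H2) by exact: (integrableD mS iF iC1).
have [[mu_ _] LDu _] := let: And4 a _ _ _ := ss in a.
have muS : measurable_fun S u by exact: (measurable_funS mOm SOm mu_).
have mDS : measurable_fun S (fun x => enorm (Du x) `^ gam).
  apply: (measurableT_comp (measurable_powR gam)); apply: measurable_enorm => i.
  by have [mi _] := LDu i; exact: (measurable_funS mOm SOm mi).
have mumS : measurable_fun S u^\- by exact: measurable_funrneg.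
have mphi : measurable_fun S phi.
  apply: continuous_leb_measurable_fun => x.
  by apply: differentiable_continuous; case: C1phi.
pose G x := kap * enorm (Du x) `^ gam * phi x + lam * u^\- x * phi x.
have G0 x : 0 <= G x.
  have /andP[p0 _] := phi01 x.
  have kge0 := ltW kap0.
  apply: addr_ge0; apply: (mulr_ge0 _ p0); apply: mulr_ge0 => //.
  exact: powR_ge0.
have mG : measurable_fun S G.
  have mk := @measurable_cst _ _ _ R S.
  exact: (measurable_funD (measurable_funM (measurable_funM (mk kap) mDS) mphi)
    (measurable_funM (measurable_funM (mk lam) mumS) mphi)).
have Gle : {ae leb, forall x, S x -> G x <= H1 x + H2 x}.
  apply: filterS2 Anu Bge => x Ax Bx /SOm Ox.
  have uE : u x = u^\+ x - u^\- x by rewrite -[in LHS](funrposBneg u).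
  rewrite /G abE; apply: pointwise_absorption => //; try exact: ltW.
  - exact: enorm_ge0.
  - exact: Ax.
  - have := Bx Ox (u x) (Du x); rewrite {1}uE abE /kap.
    by rewrite (_ : 2 * (cH / 2) = cH)//; field.
have main := ae_le_add_integral mS mG (fun x _ => G0 x) iH1 iH2 H1le0 Gle.
have mTD := measurable_funS mS TS mDS.
have mTu := measurable_funS mS TS mumS.
(* The cutoff equals 1 on the small ball, and [G] is nonnegative on the rest of [S]. *)
have low : (m%:E * (\int[leb]_(x in T) (enorm (Du x) `^ gam)%:E
    + lam%:E * \int[leb]_(x in T) (u^\- x)%:E) <=
    \int[leb]_(x in S) (G x)%:E)%E.
  have eDg x : T x -> (0 <= (enorm (Du x) `^ gam)%:E)%E.
    by move=> _; rewrite lee_fin powR_ge0.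
  have eun x : T x -> (0 <= (u^\- x)%:E)%E by move=> _; rewrite lee_fin funrneg_ge0.
  have elun x : T x -> (0 <= lam%:E * (u^\- x)%:E)%E.
    by move=> Tx; apply: mule_ge0; [rewrite lee_fin|exact: eun].
  have esum x : T x -> (0 <= (enorm (Du x) `^ gam)%:E + lam%:E * (u^\- x)%:E)%E.
    by move=> Tx; rewrite adde_ge0// ?eDg// elun.
  have emD : measurable_fun T (fun x => (enorm (Du x) `^ gam)%:E).
    exact/measurable_EFinP.
  have emu : measurable_fun T (fun x => (u^\- x)%:E) by exact/measurable_EFinP.
  have emlu : measurable_fun T (fun x => lam%:E * (u^\- x)%:E)%E.
    exact: measurable_funeM.
  rewrite -(ge0_integralZl_EFin _ mT eun emu lam0).
  rewrite -(ge0_integralD _ mT eDg emD elun emlu).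
  rewrite -(ge0_integralZl_EFin _ mT esum (emeasurable_funD emD emlu) (ltW m0)).
  apply: le_trans (ge0_subset_integral _ mT mS _ _ TS).
  - apply: (ge0_le_integral _ mT).
    + by move=> x Tx; apply: mule_ge0; [rewrite lee_fin ltW|exact: esum].
    + by apply: measurable_funeM; exact: emeasurable_funD.
    + by apply/measurable_EFinP; exact: (measurable_funS mS TS mG).
    + move=> x Tx; rewrite -EFinM lee_fin /G /phi th1// expr1n !mulr1.
      rewrite mulrDr; apply: lerD.
        by rewrite ler_wpM2r ?powR_ge0// ge_min lexx.
      rewrite -[leRHS]mul1r ler_wpM2r ?ge_min ?lexx ?orbT//.
      by apply: mulr_ge0 => //; exact: funrneg_ge0.
  - exact/measurable_EFinP.
  - by move=> x _; rewrite lee_fin.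
have up : (\int[leb]_(x in S) (H2 x)%:E <=
    (M * r `^ (N%:R - N%:R / q) + C1 * (2 * r) ^+ N)%:E)%E.
  have -> : (\int[leb]_(x in S) (H2 x)%:E =
     \int[leb]_(x in S) `|F x|%:E + \int[leb]_(x in S) C1%:E)%E.
    exact: (integralD_EFin mS iF iC1).
  rewrite integral_cst// EFinD [X in (_ <= _ + X)%E]EFinM; apply: leeD.
    exact: integral_le_morrey_norm SOm mof mou.
  by apply: lee_wpmul2l => //; rewrite lee_fin.
have fin : M * r `^ (N%:R - N%:R / q) + C1 * (2 * r) ^+ N <=
   (`|M| * delta `^ (s - N%:R / q) + C2 * 2 ^+ N * delta `^ (s - gam / a))
   * (r ^+ N / (r - t) `^ s).
  have rN0 : 0 <= r ^+ N by rewrite exprn_ge0// ltW.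
  rewrite [leRHS]mulrDl; apply: lerD.
    apply: (@le_trans _ _ (`|M| * (r ^+ N * (delta `^ (s - N%:R / q) / (r - t) `^ s)))).
      apply: (@le_trans _ _ (`|M| * r `^ (N%:R - N%:R / q))).
        by rewrite ler_wpM2r ?powR_ge0// ler_norm.
      apply: ler_wpM2l => //.
      rewrite [r `^ _]powRD; last by rewrite (gt_eqF r0) implybT.
      rewrite powR_mulrn ?(ltW r0)// ler_wpM2l//.
      apply: (@le_trans _ _ ((r - t) `^ (- (N%:R / q)))); last first.
        by apply: powRN_le_scale => //; rewrite le_max lexx.
      rewrite !powRN lef_pV2 ?posrE ?powR_gt0//.
      apply: ge0_ler_powR; rewrite ?nnegrE//; [|exact: ltW|exact: ltW|lra].
      by rewrite divr_ge0// (le_trans _ q_ge1).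
    by rewrite le_eqVlt; apply/orP; left; apply/eqP; ring.
  (* [C1] is homogeneous in L = c1 / (r - t) of degree 1 + b / a = gam / a; this is the origin of
     the second exponent in the maximum. *)
  have C1E : C1 = C2 * (r - t) `^ (- (gam / a)).
    have gaE : - (gam / a) = - 1 - b / a.
      by rewrite abE; field; rewrite gt_eqF.
    rewrite gaE powRD; last by rewrite (gt_eqF rt0) implybT.
    rewrite /C1 /C2 /L !powRN powRr1 ?(ltW rt0)//.
    have -> : nu * (c1 / (r - t)) / kap = (nu * c1 / kap) / (r - t).
      by field; rewrite !gt_eqF.
    have ck0 : 0 <= nu * c1 / kap by rewrite ltW// divr_gt0// mulr_gt0.
    rewrite powRM ?invr_ge0 ?(ltW rt0)//.
    rewrite -powR_inv1 ?(ltW rt0)// -powRrM mulN1r powRN.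
    rewrite powRN powRr1 ?(ltW rt0)//; ring.
  rewrite C1E exprMn.
  apply: (@le_trans _ _ (C2 * 2 ^+ N * r ^+ N * (delta `^ (s - gam / a) / (r - t) `^ s))).
    have -> : C2 * (r - t) `^ (- (gam / a)) * (2 ^+ N * r ^+ N) =
      C2 * 2 ^+ N * r ^+ N * (r - t) `^ (- (gam / a)) by ring.
    apply: ler_wpM2l.
      exact: mulr_ge0 (mulr_ge0 C20 (exprn_ge0 N (ler0n R 2))) rN0.
    by apply: powRN_le_scale => //; rewrite le_max lexx orbT.
  by rewrite le_eqVlt; apply/orP; left; apply/eqP; ring.
have := le_trans low (le_trans main up).
rewrite -[X in _ -> (_ <= X%:E)%E]mulrA [X in _ -> (_ <= X)%E]EFinM.
by rewrite lee_pdivlMl//; move/le_trans; apply; rewrite lee_fin.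
Qed.
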